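(* For every prime $p$, every skew morphism of the cyclic group $\mathrm{C}_{8p}$ is coset-preserving.
   Context: For a finite group $B$, a skew morphism of $B$ is a permutation $\varphi$ of $B$ fixing the identity such that for every $a\in B$ there is a positive integer $i_a$ with $\varphi(ab)=\varphi(a)\varphi^{i_a}(b)$ for all $b\in B$. Its order $\mathrm{ord}(\varphi)$ is the order of $\langle\varphi\rangle$. The power function $\pi$ maps $a$ to the unique such $i_a\in\{1,\dots,\mathrm{ord}(\varphi)\}$ (with $\pi\equiv1$ for the identity). $\varphi$ is coset-preserving if $\pi(\varphi(a))=\pi(a)$ for all $a\in B$. *)

(* Defs.v *)
From mathcomp Require Import all_boot all_fingroup cyclic.

Set Implicit Arguments.
Unset Strict Implicit.
Unset Printing Implicit Defensive.

Local Open Scope group_scope.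

(* The finite group B is the whole of a finGroupType. Powers [phi ^+ i] are
   taken in the group {perm B}, so [(phi ^+ i) b] is the i-fold iterate of phi
   at b, and #[phi] is the order of the subgroup <[phi]> of {perm B}. *)

Definition skew_exponent (B : finGroupType) (phi : {perm B}) (a : B)
    (i : nat) : bool :=
  [forall b, phi (a * b) == phi a * (phi ^+ i) b].

Definition skew_morphism (B : finGroupType) (phi : {perm B}) : Prop :=
  phi 1 = 1 /\ forall a : B, exists2 i : nat, 0 < i & skew_exponent phi a i.

(* The index j : 'I_#[phi] stands for the exponent j.+1 in {1, ..., #[phi]}; the
   default 0 is never taken when phi is a skew morphism (see
   skew_powerP below). *)
Definition skew_power (B : finGroupType) (phi : {perm B}) (a : B) : nat :=
  if [pick j : 'I_#[phi] | skew_exponent phi a j.+1] is Some j then j.+1 else 0.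

Definition coset_preserving (B : finGroupType) (phi : {perm B}) : Prop :=
  forall a : B, skew_power phi (phi a) = skew_power phi a.

Lemma skew_powerP (B : finGroupType) (phi : {perm B}) (a : B) :
  skew_morphism phi ->
  0 < skew_power phi a <= #[phi] /\ skew_exponent phi a (skew_power phi a).
Proof.
case=> _ /(_ a) [i i_gt0 Hi]; rewrite /skew_power; case: pickP => [j Hj|no].
  by split; first exact: ltn_ord.
have lt_r : i.-1 %% #[phi] < #[phi] by rewrite ltn_mod order_gt0.
case/negP: (negbT (no (Ordinal lt_r))) => /=.
apply/forallP => b; move/forallP/(_ b): Hi => /eqP ->.
by rewrite -{1}(prednK i_gt0) !expgS expg_mod_order.
Qed.

Lemma skew_power_unique (B : finGroupType) (phi : {perm B}) (a : B) (i : nat) :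
  skew_morphism phi -> 0 < i <= #[phi] -> skew_exponent phi a i ->
  skew_power phi a = i.
Proof.
move=> Hphi /andP[i_gt0 i_le] /forallP Hi.
have [/andP[k_gt0 k_le] /forallP Hk] := skew_powerP a Hphi.
move: (skew_power phi a) k_gt0 k_le Hk => k k_gt0 k_le Hk.
have: phi ^+ k = phi ^+ i.
  apply/permP => b; apply: (mulgI (phi a)).
  by rewrite -(eqP (Hi b)) -(eqP (Hk b)).
case: k i k_gt0 k_le {Hk} i_gt0 i_le {Hi} => [|k] [|i] // _ k_le _ i_le.
rewrite !expgS => /mulgI /eqP.
by rewrite eq_expg_mod_order !modn_small // => /eqP ->.
Qed.

(* Main.v *)
Require Import Defs.
From mathcomp Require Import all_boot all_fingroup all_solvable.

(* The right translations of B and <phi> form a group G = B C with C = <phi>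
   cyclic, core-free and meeting B trivially. Let K be the core of B in G; then
   phi is coset-preserving as soon as C K is normal in G. Counting shows that K
   is nontrivial. In G / K, where B / K is core-free, let D be the core of C / K
   and E the subgroup of D coming from elements that centralize K: E is cyclic,
   normal, and #|E| divides #|K|. If H is the subgroup of B / K that becomes the
   core of B / K modulo D, then H * E is normal and #|H| <= #|E|, and G / K / D
   is a smaller factorization of the same kind. If K is a 2-group, so is B, by
   induction. Hence, with #|B| = 8 p, B / K is always a 2-group; either its
   involution z does not centralize E, and then C / K is the centralizer of E in
   G / K, or z centralizes E and every case leads to a contradiction. *)

Set Implicit Arguments.
Unset Strict Implicit.
Unset Printing Implicit Defensive.

Local Open Scope group_scope.

(** * Factorizations into two cyclic subgroups, and their cores *)

Definition bicyclic (gT : finGroupType) (G B C : {group gT}) :=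
  [/\ B * C = G, B :&: C = 1, cyclic B & cyclic C].

Section Bicyclic.

Variable gT : finGroupType.
Implicit Types G B C N : {group gT}.

Lemma bicyclicC G B C : bicyclic G B C -> bicyclic G C B.
Proof.
case=> defG tiBC cycB cycC; split=> //; last by rewrite setIC.
by rewrite -(comm_group_setP _) // defG groupP.
Qed.

Lemma bicyclic_sub G B C : bicyclic G B C -> B \subset G /\ C \subset G.
Proof. by case=> <- _ _ _; rewrite mulG_subl mulG_subr. Qed.

Lemma bicyclic_card G B C : bicyclic G B C -> #|G| = (#|B| * #|C|)%N.
Proof. by case=> <- tiBC _ _; apply: TI_cardMg. Qed.

Lemma bicyclic_quotient G B C N :
  bicyclic G B C -> N <| G -> N \subset B ->
  bicyclic (G / N) (B / N) (C / N).
Proof.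
move=> bicG /andP[_ nNG] sNB; have [sBG sCG] := bicyclic_sub bicG.
case: bicG => defG tiBC cycB cycC; split; rewrite ?quotient_cyclic //=.
  by rewrite -quotientMl ?defG // (subset_trans sBG).
by rewrite -quotientGI // tiBC quotient1.
Qed.

Lemma mem_gcore G B x :
  (forall g, g \in G -> x ^ g \in B) -> x \in gcore B G.
Proof.
move=> xB; apply/bigcapP => g Gg.
by rewrite mem_conjg xB // groupV.
Qed.

(* A subgroup of a cyclic group is determined by its order, so [y] moves
   [X :&: X :^ y] to itself inside [X :^ y]. *)
Lemma sub_gcore_capJ G B C y :
  bicyclic G B C -> C :=: <[y]> -> B :&: B :^ y \subset gcore B G.
Proof.
case=> defG _ cycB _ defC; apply: gcore_max; first exact: subsetIl.
have cycBy : cyclic (B :^ y) by rewrite cyclicJ.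
rewrite -defG mul_subG //.
  by rewrite cents_norm // (subset_trans (cyclic_abelian cycB)) //
     centS ?subsetIl.
rewrite defC cycle_subG inE.
suffices /eqP -> : (B :&: B :^ y) :^ y == B :&: B :^ y by [].
rewrite (eq_subG_cyclic (G := (B :^ y)%G) (H := ((B :&: B :^ y) :^ y)%G)
           (K := (B :&: B :^ y)%G)) //.
- by rewrite cardJg.
- by rewrite conjSg subsetIl.
exact: subsetIr.
Qed.

Lemma gcore_capJ G B C y :
  bicyclic G B C -> C :=: <[y]> -> gcore B G = 1 -> B :&: B :^ y = 1.
Proof. by move=> bicG defC cB1; apply/trivgP; rewrite -cB1; apply: sub_gcore_capJ defC. Qed.

(* Counting [C * C :^ b] inside [G] gives [#|C| < #|B|], and then [B * B :^ c]
   is too small for [B :&: B :^ c] to be trivial. *)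
Lemma gcore_neq1 G B C :
  bicyclic G B C -> gcore C G = 1 -> B :!=: 1 -> gcore B G != 1.
Proof.
move=> bicG cC1 ntB; apply: contraNneq ntB => cB1.
have [/cyclicP[b defB] /cyclicP[c defC]] : cyclic B /\ cyclic C by case: bicG.
have [sBG sCG] := bicyclic_sub bicG.
have cardG := bicyclic_card bicG.
have tiB : B :&: B :^ c = 1.
  exact: gcore_capJ bicG defC cB1.
have tiC : C :&: C :^ b = 1.
  exact: gcore_capJ (bicyclicC bicG) defB cC1.
have Gb : b \in G by rewrite (subsetP sBG) // defB cycle_id.
have Gc : c \in G by rewrite (subsetP sCG) // defC cycle_id.
have sBBG : B * B :^ c \subset G by rewrite mul_subG // -(conjGid Gc) conjSg.
have sCCG : C * C :^ b \subset G by rewrite mul_subG // -(conjGid Gb) conjSg.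
have leBC : #|B| <= #|C|.
  have := subset_leq_card sBBG.
  by rewrite TI_cardMg // cardJg cardG leq_pmul2l.
have leCB : #|C| * #|C| >= #|G| by rewrite cardG leq_mul2r leBC orbT.
have defCC : C * C :^ b = G.
  by apply/eqP; rewrite eqEcard sCCG TI_cardMg // cardJg.
(* No group is the product of a proper subgroup and a conjugate of it: [b = x * z ^ b] rearranges to
   [b = z * x], which lies in [C]. *)
have: b \in C * C :^ b by rewrite defCC.
case/mulsgP => x y Cx; case/imsetP => z Cz -> eq_b.
have Cb : b \in C.
  have -> : b = z * x.
    have: x * b^-1 * z = 1.
      by apply: (mulIg b); rewrite mul1g [in RHS]eq_b conjgE !mulgA.
    move=> eq1; have -> : x = (b^-1 * z)^-1.
      by rewrite -[LHS](mulgK (b^-1 * z)) mulgA eq1 mul1g.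
    by rewrite invMg invgK mulKVg.
  exact: groupM.
have: b \in B :&: C by rewrite inE Cb defB cycle_id.
by case: bicG => _ -> _ _ /set1gP b1; rewrite defB b1 cycle1.
Qed.


(** The preimage of the core of [B / K] is a normal subgroup of [G] inside [B], hence lies in
    [K]. *)
Lemma gcore_quotient_gcore G B :
  B \subset G -> gcore (B / gcore B G) (G / gcore B G) = 1.
Proof.
move=> sBG; set K := gcore B G; set M := gcore _ _.
have sKB : K \subset B := gcore_sub B G.
have nKG : G \subset 'N(K) := gcore_norm B G.
have sPK : coset K @*^-1 M \subset K.
  apply: gcore_max.
    rewrite -{1}(mulSGid sKB) -quotientK ?(subset_trans sBG) //.
    by rewrite cosetpreSK gcore_sub.
  by rewrite norm_quotient_pre // gcore_norm.
rewrite -[M]cosetpreK; apply/trivgP.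
by rewrite quotient_sub1 // (subset_trans sPK) ?normG.
Qed.

(* If [t ^ g = n * t ^ i] with [n] in [N] then [(t ^+ #|N|) ^ g] is a power of
   [t]; hence [t ^+ #|N|] lies in the core of [C]. *)
Lemma order_dvd_normal G B C N t :
    bicyclic G B C -> gcore C G = 1 -> N <| G -> t \in C -> t \in 'C(N) ->
  <[coset N t]> <| G / N -> #[t] %| #|N|.
Proof.
move=> bicG cC1 /andP[_ nNG] Ct cNt /andP[_ ntG].
have [_ sCG] := bicyclic_sub bicG.
have nNt : t \in 'N(N) by rewrite (subsetP (cent_sub _)).
suffices: t ^+ #|N| \in gcore C G.
  by rewrite cC1 => /set1gP t1; rewrite order_dvdn t1.
apply: mem_gcore => g Gg; have nNg := subsetP nNG g Gg.
have : coset N (t ^ g) \in <[coset N t]>.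
  rewrite morphJ // memJ_norm ?cycle_id //.
  by rewrite (subsetP ntG) // mem_quotient.
case/cycleP => i; rewrite -morphX //= => /rcoset_kercosetP.
rewrite groupJ // groupX // => /(_ isT isT) /rcosetP[n Nn eq_tg].
have cnt : commute n (t ^+ i).
  by apply/commuteX/commute_sym; apply: (centP cNt).
by rewrite conjXg eq_tg expgMn // expg_cardG // mul1g !groupX.
Qed.

End Bicyclic.

(** * The reduction to a smaller factorization *)

(* [K2 * E] is the intersection of two normal subgroups: the image of ['C_G(K)]
   and the preimage of the core of [B] modulo the core [D] of [C]. *)
Lemma gcore_step (gT : finGroupType) (G B C : {group gT}) (K := gcore B G) :
    bicyclic G B C -> gcore C G = 1 ->
  exists E K2 : {group coset_of K},
    [/\ E <| G / K, E \subset 'C_C(K) / K, #|E| %| #|K| &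
    [/\ K2 \subset B / K, K2 * E <| G / K &
    exists (rT : finGroupType) (G' B' C' : {group rT}),
      [/\ bicyclic G' B' C', gcore C' G' = 1,
          #|B'| = #|B / K| & #|gcore B' G'| = #|K2|]]].
Proof.
move=> bicG cC1; have [sBG sCG] := bicyclic_sub bicG.
have [_ _ cycB cycC] := bicG.
have sKB : K \subset B := gcore_sub B G.
have nsKG : K <| G := gcore_normal sBG.
have nKG := normal_norm nsKG.
have cKB : B \subset 'C(K).
  by rewrite (subset_trans (cyclic_abelian cycB)) // centS.
have bicQ := bicyclic_quotient bicG nsKG sKB.
have [defQ tiQ cycBq cycCq] := bicQ; have [sBQ sCQ] := bicyclic_sub bicQ.
set D := gcore (C / K) (G / K).
have nsDQ : D <| G / K := gcore_normal sCQ.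
have sDC : D \subset C / K := gcore_sub _ _.
have nDQ := normal_norm nsDQ.
set Z := 'C_G(K) / K.
have nsZQ : Z <| G / K.
  by rewrite quotient_normal // /normal subsetIl normsI ?normG ?norms_cent.
have sBZ : B / K \subset Z by rewrite quotientS // subsetI sBG.
have bicD := bicyclicC (bicyclic_quotient (bicyclicC bicQ) nsDQ sDC).
have [sBD sCD] := bicyclic_sub bicD.
set M := gcore (B / K / D) (G / K / D).
have nsMD : M <| G / K / D := gcore_normal sBD.
set P := coset D @*^-1 M.
have nsPQ : P <| G / K.
  rewrite -(quotientGK nsDQ) /P cosetpre_normal //.
have tiBD : B / K :&: D = 1.
  by apply/trivgP; rewrite -tiQ setIS.
have nDB : B / K \subset 'N(D) := subset_trans sBQ nDQ.
have sDP : D \subset P := sub_cosetpre _.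
pose E := (Z :&: D)%G; pose K2 := (B / K :&: P)%G.
(* Modular law: modulo [D], the group [P] lies in the image of [B / K]. *)
have defP : K2 * D = P.
  rewrite /= setIC group_modr //; apply/setIidPl.
  by rewrite (normC nDB) -quotientK // cosetpreSK gcore_sub.
have nsEQ : E <| G / K by apply: normalI.
(* Lifts of [e] to [C] and to ['C_G(K)] differ by an element of [K], and [K] is abelian, so the lift
   to [C] centralizes [K] as well. *)
have sEC : E \subset 'C_C(K) / K.
  apply/subsetP => e /setIP[Ze /(subsetP sDC)/morphimP[c nKc Cc def_e]].
  rewrite def_e mem_quotient // inE Cc.
  move: Ze; rewrite def_e => /morphimP[x nKx /setIP[_ cKx]].
  move/rcoset_kercosetP => /(_ nKc nKx)/rcosetP[k Kk ->].
  by rewrite groupM // (subsetP cKB) // (subsetP sKB).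
exists E, K2; split=> //.
  have /cyclicP[e defE] : cyclic E.
    by rewrite (cyclicS _ cycCq) // subIset // sDC orbT.
  have : e \in E by rewrite defE cycle_id.
  case/(subsetP sEC)/morphimP => c nKc /setIP[Cc cKc] def_e.
  rewrite defE -/(order e) def_e; apply: dvdn_trans (morph_order _ nKc) _.
  apply: order_dvd_normal bicG cC1 nsKG Cc cKc _.
  by rewrite -def_e -defE.
split; first exact: subsetIl.
- have -> : K2 * E = P :&: Z.
    have sK2Z : K2 \subset Z by rewrite subIset // sBZ.
    by rewrite /= (setIC Z) group_modl // defP.
  exact: normalI.
exists _, (G / K / D)%G, (B / K / D)%G, (C / K / D)%G; split=> //.
- exact: gcore_quotient_gcore.
- by rewrite -(card_isog (quotient_isog nDB _)) // setIC.
apply/eqP; rewrite -(eqn_pmul2l (cardG_gt0 D)) -card_cosetpre -[coset _ @*^-1 _]/P.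
rewrite -defP TI_cardMg 1?mulnC //.
by apply/trivgP; rewrite -tiBD setSI // subsetIl.
Qed.

(** * Consequences of the reduction: 2-groups and bounds on cores *)

(** Write a conjugate of [x] as [a * e] with [a] in [H] and [e] in [E]. It centralizes [E], so [a]
    and [e] commute, and raising to the power [#[x]] puts [e ^+ #[x]] in [B :&: E = 1]. Coprimality
    gives [e = 1]; thus all conjugates of [x] lie in [B]. *)
Lemma central_coprime_eq1 (gT : finGroupType) (G B E H : {group gT}) x :
    gcore B G = 1 -> B :&: E = 1 -> E <| G -> abelian E ->
    H \subset B -> H * E <| G ->
  x \in H -> x \in 'C(E) -> coprime #|E| #[x] -> x = 1.
Proof.
move=> cB1 tiBE /andP[sEG nEG] abE sHB /andP[_ nHEG] Hx cEx co_xE.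
suffices: x \in gcore B G by rewrite cB1 => /set1gP.
apply: mem_gcore => g Gg.
have: x ^ g \in H * E.
  rewrite memJ_norm ?(subsetP nHEG) //.
  by apply/mulsgP; exists x 1; rewrite ?mulg1.
have cExg : x ^ g \in 'C(E).
  by rewrite memJ_norm // (subsetP (norms_cent nEG)).
case/mulsgP=> a e Ha Ee eq_xg.
have cea : commute a e.
  apply: (centP _ e Ee); rewrite -[a](mulgK e) -eq_xg.
  by rewrite groupM // groupV (subsetP abE).
suffices e1 : e = 1 by rewrite eq_xg e1 mulg1 (subsetP sHB).
apply/eqP; rewrite -order_eq1 -dvdn1 -(eqnP co_xE) dvdn_gcd order_dvdG //=.
rewrite order_dvdn -in_set1 -[[set _]]/(1%g : {set gT}) -tiBE inE.
rewrite [X in _ && X]groupX // andbT -groupV (subsetP sHB) //.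
suffices -> : (e ^+ #[x])^-1 = a ^+ #[x] by rewrite groupX.
by apply: (mulIg (e ^+ #[x])); rewrite mulVg -expgMn // -eq_xg -conjXg expg_order conj1g.
Qed.

(** The automorphism group of a cyclic 2-group is itself a 2-group. *)
Lemma odd_cent_cyclic2 (gT : finGroupType) (E : {group gT}) x :
  cyclic E -> 2.-group E -> x \in 'N(E) -> odd #[x] -> x \in 'C(E).
Proof.
move=> cycE E2 nEx odd_x; rewrite -ker_conj_aut.
apply/kerP => //; apply/eqP; rewrite -order_eq1 -dvdn1.
have [i cardE] := p_natP E2.
have co_x : coprime #[x] (2 ^ i.-1) by rewrite coprimeXr // coprimen2.
have <- : gcdn #[x] (2 ^ i.-1) = 1%N by exact/eqP.
rewrite dvdn_gcd morph_order //=.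
have: conj_aut E x \in Aut E.
  by rewrite (subsetP (Aut_conj_aut E 'N(E))) // mem_morphim.
move/order_dvdG; rewrite card_Aut_cyclic // cardE.
by case: i {cardE co_x} => // i; rewrite totient_pfactor //= mul1n.
Qed.

Lemma card_core_quotient (gT : finGroupType) (G B : {group gT}) :
  B \subset G -> #|B| = (#|gcore B G| * #|B / gcore B G|)%N.
Proof.
move=> sBG; rewrite card_quotient ?Lagrange ?gcore_sub //.
exact: subset_trans (gcore_norm _ _).
Qed.

(** Induction on [#|B|] through [gcore_step]. Since [#|E|] divides the order of the core, [E] is a
    2-group; an element of odd prime order in [H] then centralizes [E] and is trivial by
    [central_coprime_eq1]. So the next core is again a 2-group. *)
Lemma gcore_2group (gT : finGroupType) (G B C : {group gT}) :
    bicyclic G B C -> gcore C G = 1 -> 2.-group (gcore B G) ->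
  2.-group B.
Proof.
have [m] := ubnP #|B|.
elim: m gT G B C => // m IHm gT G B C ltBm bicG cC1 K2group.
have [-> | ntB] := eqVneq (B : {set gT}) 1; first exact: pgroup1.
have [sBG _] := bicyclic_sub bicG; have cardB := card_core_quotient sBG.
have [E [H [nsEQ sECK dvE [sHB nsHE [rT [G' [B' [C' [bic' cC1' cardB' cardK']]]]]]]]]
  := gcore_step bicG cC1.
have bicQ := bicyclic_quotient bicG (gcore_normal sBG) (gcore_sub _ _).
have sEC := subset_trans sECK (quotientS _ (subsetIl C _)).
have tiBE : (B / gcore B G)%g :&: E = 1.
  by case: bicQ => _ tiQ _ _; apply/trivgP; rewrite -tiQ setIS.
have cycE : cyclic E by case: bicQ => _ _ _; apply: cyclicS.
have E2group : 2.-group E by apply: pnat_dvd dvE K2group.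
rewrite /pgroup cardB pnatM [X in X && _]K2group -cardB' /=.
apply: IHm bic' cC1' _.
  rewrite cardB'; apply: (leq_trans _ (ltBm : #|B| <= m)).
  rewrite cardB ltn_Pmull //.
  by rewrite cardG_gt1 (gcore_neq1 bicG).
rewrite /pgroup cardK'; apply/pgroupP => q q_pr /(Cauchy q_pr)[x Hx ox].
rewrite inE /=; apply: contraLR (prime_gt1 q_pr) => q_neq2.
have odd_q : odd q by case: (even_prime q_pr) q_neq2 => [->|].
have nEx : x \in 'N(E).
  rewrite (subsetP (normal_norm nsEQ)) // (subsetP _ x (subsetP sHB x Hx)) //.
  by case: (bicyclic_sub bicQ).
rewrite -ox (_ : x = 1) ?order1 //.
apply: (central_coprime_eq1 _ tiBE nsEQ _ sHB nsHE Hx).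
- exact: gcore_quotient_gcore.
- exact: cyclic_abelian.
- by apply: odd_cent_cyclic2; rewrite ?ox.
have [i ->] := p_natP E2group.
by rewrite coprimeXl // ox coprime2n.
Qed.

(** For a generator [c] of [C], the groups [H] and [H :^ c] meet trivially and both lie in [H * E],
    so [#|H|] squared is at most [#|H| * #|E|]. *)
Lemma card_le_normal_mul (gT : finGroupType) (G B C H E : {group gT}) :
    bicyclic G B C -> gcore B G = 1 -> H \subset B -> E \subset C ->
  E <| G -> H * E <| G -> #|H| <= #|E|.
Proof.
move=> bicG cB1 sHB sEC nsEG /andP[sHEG nHEG].
have [sBG sCG] := bicyclic_sub bicG; have [_ tiBC _ /cyclicP[c defC]] := bicG.
have tiB := gcore_capJ bicG defC cB1.
have tiH : H :&: H :^ c = 1 by apply/trivgP; rewrite -tiB setISS ?conjSg.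
have tiHE : H :&: E = 1 by apply/trivgP; rewrite -tiBC setISS.
have Gc : c \in G by rewrite (subsetP sCG) // defC cycle_id.
have gHE : group_set (H * E).
  apply/comm_group_setP/normC.
  by rewrite (subset_trans sHB) // (subset_trans sBG) // normal_norm.
have : H * H :^ c \subset Group gHE.
  rewrite mul_subG ?mulG_subl //= -(normsP nHEG c Gc) conjSg.
  exact: mulG_subl.
move/subset_leq_card; rewrite /= !TI_cardMg ?cardJg //.
by rewrite leq_pmul2l.
Qed.

Lemma gcore_next (gT : finGroupType) (G B C : {group gT}) :
    bicyclic G B C -> gcore C G = 1 ->
  exists (rT : finGroupType) (G' B' C' : {group rT}),
    [/\ bicyclic G' B' C', gcore C' G' = 1, #|B'| = #|B / gcore B G|
      & #|gcore B' G'| <= #|gcore B G|].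
Proof.
move=> bicG cC1; have [sBG _] := bicyclic_sub bicG.
have [E [H [nsEQ sECK dvE [sHB nsHE [rT [G' [B' [C' [bic' cC1' cardB' cardK']]]]]]]]]
  := gcore_step bicG cC1.
have bicQ := bicyclic_quotient bicG (gcore_normal sBG) (gcore_sub _ _).
exists rT, G', B', C'; split=> //; rewrite cardK'.
apply: leq_trans (dvdn_leq (cardG_gt0 _) dvE).
apply: card_le_normal_mul bicQ _ sHB _ nsEQ nsHE; first exact: gcore_quotient_gcore.
exact: subset_trans sECK (quotientS _ (subsetIl C _)).
Qed.

(** * Factors of small order and involutions *)

Lemma cent_order_dvd2 (gT : finGroupType) (K : {group gT}) :
  #|K| %| 2 -> 'N(K) \subset 'C(K).
Proof.
move=> dvK; apply/subsetP => x nKx; rewrite -ker_conj_aut.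
have cardK : #|K| \in [:: 1; 2]%N by rewrite -[[:: _; _]]/(divisors 2) -dvdn_divisors.
have cycK : cyclic K.
  move: cardK; rewrite !inE => /orP[]/eqP cardK; last by rewrite prime_cyclic ?cardK.
  by rewrite (card1_trivg cardK) cyclic1.
apply/kerP => //; apply/eqP; rewrite -order_eq1 -dvdn1.
have: conj_aut K x \in Aut K.
  by rewrite (subsetP (Aut_conj_aut K 'N(K))) // mem_morphim.
move/order_dvdG; rewrite card_Aut_cyclic //.
by move: cardK; rewrite !inE => /orP[]/eqP->.
Qed.

Lemma bicyclic_index2 (gT : finGroupType) (G B C : {group gT}) :
  bicyclic G B C -> #|B| <= 2 -> C <| G.
Proof.
move=> bicG le_B2; have [_ sCG] := bicyclic_sub bicG.
have : #|G : C| = #|B|.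
  by rewrite -divgS // (bicyclic_card bicG) mulnK.
case: #|B| (cardG_gt0 B) le_B2 => [|[|[|[]]]] // _ _; last exact: index2_normal.
by move=> iC1; rewrite (index1g sCG iC1) normal_refl.
Qed.

(** If the core had order 2, it would be central and [C] would be normal modulo it. Then
    [order_dvd_normal] bounds [#|C|] by 2, so [B] has index at most 2, is normal, and is its own
    core. *)
Lemma gcore_order4 (gT : finGroupType) (G B C : {group gT}) :
  bicyclic G B C -> gcore C G = 1 -> #|B| = 4 -> #|gcore B G| = 4.
Proof.
move=> bicG cC1 cardB; have [sBG sCG] := bicyclic_sub bicG.
have ntB : B :!=: 1 by rewrite -cardG_gt1 cardB.
have ntK := gcore_neq1 bicG cC1 ntB.
have: #|gcore B G| \in divisors 4 by rewrite -dvdn_divisors // -cardB cardSg ?gcore_sub.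
rewrite !inE -trivg_card1 (negPf ntK) /= => /orP[/eqP k2 | /eqP //].
have nsKG := gcore_normal sBG.
have bicQ := bicyclic_quotient bicG nsKG (gcore_sub _ _).
have cardQ := card_core_quotient sBG.
have nsCQ : C / gcore B G <| G / gcore B G.
  apply: bicyclic_index2 bicQ _.
  by rewrite -(leq_pmul2l (isT : 0 < 2)) -[X in (X * _)%N]k2 -cardQ cardB.
have [_ _ _ /cyclicP[c defC]] := bicG.
have Cc : c \in C by rewrite defC cycle_id.
have nKc : c \in 'N(gcore B G) by rewrite (subsetP (gcore_norm _ _)) // (subsetP sCG).
have cKc : c \in 'C(gcore B G).
  by rewrite (subsetP (cent_order_dvd2 _)) //= k2.
have: #[c] %| #|gcore B G|.
  apply: order_dvd_normal bicG cC1 nsKG Cc cKc _.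
  by rewrite -quotient_cycle // -defC.
rewrite k2 orderE -defC => /(dvdn_leq (isT : 0 < 2)) le_C2.
have nsBG := bicyclic_index2 (bicyclicC bicG) le_C2.
have sBK : B \subset gcore B G by rewrite gcore_max // normal_norm.
have := subset_leq_card sBK; rewrite k2 cardB //.
Qed.

(** As [C] is abelian and contains [E], the centralizer of [E] in [G] is the product of ['C_B(E)]
    and [C]. If ['C_B(E)] is trivial, [C] is the centralizer of a normal subgroup; otherwise
    Cauchy's theorem applies. *)
Lemma cent_normal_dichotomy (gT : finGroupType) (G B C E : {group gT}) :
    bicyclic G B C -> 2.-group B -> E <| G -> E \subset C ->
  C <| G \/ exists z, [/\ z \in B, #[z] = 2 & z \in 'C(E)].
Proof.
move=> bicG B2 /andP[sEG nEG] sEC; have [sBG sCG] := bicyclic_sub bicG.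
have [defG _ _ cycC] := bicG.
have [cBE1 | ntcBE] := eqVneq 'C_B(E) 1.
  left; suffices -> : C = 'C_G(E)%G.
    by rewrite /normal subsetIl normsI ?normG ?norms_cent.
  apply: val_inj; rewrite /= -defG setIC -group_modr.
    by rewrite setIC cBE1 mul1g.
  by rewrite (subset_trans (cyclic_abelian cycC)) ?centS.
right; have: 2.-group 'C_B(E) by apply: pgroupS B2; apply: subsetIl.
move/pgroup_pdiv => /(_ ntcBE)[_ dv2 _].
have [z /setIP[Bz cEz] oz] := Cauchy (isT : prime 2) dv2.
by exists z.
Qed.

Lemma involution_cyclic (gT : finGroupType) (B : {group gT}) x z :
  cyclic B -> x \in B -> z \in B -> #[x] = 2 -> #[z] = 2 -> x = z.
Proof.
move=> cycB Bx Bz ox oz.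
have /eqP/setP/(_ x) : <[x]>%G == <[z]>%G :> {set gT}.
  by rewrite (eq_subG_cyclic cycB) ?cycle_subG // -!orderE ox oz.
rewrite /= cycle_id (cycle2g oz) !inE => /esym/orP[] /eqP // x1.
by rewrite x1 order1 in ox.
Qed.

(** * The possible orders of the quotient of [B] by its core *)

(** Here [#|E|] is odd. The nontrivial 2-group [H] contains the unique involution of the cyclic
    quotient, so [central_coprime_eq1] keeps that involution from centralizing [E]. *)
Lemma core_quotient_order8 (gT : finGroupType) (G B C : {group gT}) p :
    bicyclic G B C -> gcore C G = 1 -> odd p ->
    #|gcore B G| = p -> #|B / gcore B G| = 8 ->
  C / gcore B G <| G / gcore B G.
Proof.
move=> bicG cC1 odd_p cardK cardQ; have [sBG sCG] := bicyclic_sub bicG.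
have [E [H [nsEQ sECK dvE [sHB nsHE [rT [G' [B' [C' [bic' cC1' cardB' cardK']]]]]]]]]
  := gcore_step bicG cC1.
have bicQ := bicyclic_quotient bicG (gcore_normal sBG) (gcore_sub _ _).
have [_ tiQ cycBq cycCq] := bicQ.
have sEC := subset_trans sECK (quotientS _ (subsetIl C _)).
have B2 : 2.-group (B / gcore B G) by rewrite /pgroup cardQ.
have [// | [z [Bz oz cEz]]] := cent_normal_dichotomy bicQ B2 nsEQ sEC.
have ntH : H :!=: 1.
  rewrite -cardG_gt1 -cardK' cardG_gt1 (gcore_neq1 bic' cC1') //.
  by rewrite -cardG_gt1 cardB' cardQ.
have [_ dv2 _] := pgroup_pdiv (pgroupS sHB B2) ntH.
have [y Hy oy] := Cauchy (isT : prime 2) dv2.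
have eq_yz : y = z := involution_cyclic cycBq (subsetP sHB y Hy) Bz oy oz.
have tiBE : (B / gcore B G)%g :&: E = 1 by apply/trivgP; rewrite -tiQ setIS.
have z1 : z = 1.
  apply: (central_coprime_eq1 _ tiBE nsEQ _ sHB nsHE _ cEz).
  - exact: gcore_quotient_gcore.
  - exact: cyclic_abelian (cyclicS sEC cycCq).
  - by rewrite -eq_yz.
  rewrite oz coprimen2; apply: contraTT odd_p.
  by rewrite -!dvdn2 -cardK => /dvdn_trans; apply.
by rewrite z1 order1 in oz.
Qed.

(** Since [z = b ^+ 2], its conjugate is the square of [a * e]; and [a ^+ 2] is either 1 or [z]. *)
Lemma square_conj_order4 (gT : finGroupType) (G B E : {group gT}) b z g :
    B :=: <[b]> -> #|B| = 4 -> z \in B -> #[z] = 2 -> z \in 'C(E) ->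
    B * E <| G -> g \in G ->
  exists a e, [/\ a \in B, e \in E, b ^ g = a * e, a ^+ 2 \in 'C(E)
                & z ^ g = a ^+ 2 * (e ^ a * e)].
Proof.
move=> defB cardB Bz oz cEz /andP[_ nBE] Gg.
have ob : #[b] = 4 by rewrite orderE -defB.
have cycB : cyclic B by rewrite defB cycle_cyclic.
have Bb : b \in B by rewrite defB cycle_id.
have defz : z = b ^+ 2.
  by apply: (involution_cyclic cycB) => //; rewrite ?groupX // orderXdiv ob.
have: b ^ g \in B * E.
  by rewrite memJ_norm ?(subsetP nBE) // -[b]mulg1 mem_mulg.
case/mulsgP=> a e Ba Ee eq_bg; exists a, e; split=> //.
  have [-> | nt] := eqVneq (a ^+ 2) 1; first exact: group1.
  rewrite (involution_cyclic (x := a ^+ 2) cycB _ Bz _ oz) ?groupX //.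
  apply: nt_prime_order => //; rewrite -expgM; apply/eqP.
  by rewrite -order_dvdn; have := order_dvdG Ba; rewrite cardB.
by rewrite defz conjXg eq_bg conjgE !expgS expg0 !mulg1 !mulgA mulgK.
Qed.

(* Conjugating a generator of [B] gives [a * e] with [e] in [E], and the
   component [e ^ a * e] of [z ^ g] is killed by both 2 and [p]. *)
Lemma no_order4_odd (gT : finGroupType) (G B E : {group gT}) z p :
    gcore B G = 1 -> B \subset G -> E <| G -> B * E <| G ->
    cyclic B -> cyclic E -> #|B| = 4 -> odd p -> #|E| %| 2 * p ->
    z \in B -> #[z] = 2 -> z \in 'C(E) -> False.
Proof.
move=> cB1 sBG /andP[_ nEG] nsBE /cyclicP[b defB] cycE cardB odd_p dvE Bz oz cEz.
suffices z1 : z = 1 by rewrite z1 order1 in oz.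
suffices: z \in gcore B G by rewrite cB1 => /set1gP.
apply: mem_gcore => g Gg.
have [a [e [Ba Ee _ cEa2 eq_zg]]] := square_conj_order4 defB cardB Bz oz cEz nsBE Gg.
have nEa : a \in 'N(E) by rewrite (subsetP nEG) // (subsetP sBG).
have Eea : e ^ a \in E by rewrite memJ_norm.
have abE := cyclic_abelian cycE.
have ce : commute (e ^ a) e by apply: (centsP abE).
suffices -> : z ^ g = a ^+ 2 by rewrite groupX.
rewrite eq_zg; set h := _ * e.
have Eh : h \in E by rewrite groupM.
suffices -> : h = 1 by rewrite mulg1.
apply/eqP; rewrite -order_eq1 -dvdn1.
have <- : gcdn 2 p = 1%N by apply/eqP; rewrite -/(coprime _ _) coprime2n.
rewrite dvdn_gcd !order_dvdn; apply/andP; split.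
  have: (z ^ g) ^+ 2 == 1 by rewrite -conjXg -oz expg_order conj1g.
  rewrite eq_zg -/h expgMn; last exact/(centP cEa2).
  rewrite -expgM (_ : a ^+ 4 = 1) ?mul1g //.
  by apply/eqP; rewrite -order_dvdn -cardB order_dvdG.
have e2p : e ^+ (p * 2) = 1.
  by apply/eqP; rewrite mulnC -order_dvdn (dvdn_trans (order_dvdG Ee)).
(* The subgroup generated by [e ^+ p] is characteristic in [E] and has order at most 2, so [a]
   centralizes it. *)
have cep : e ^+ p ^ a = e ^+ p.
  have sF : <[e ^+ p]> \subset E by rewrite cycle_subG groupX.
  have nFa : a \in 'N(<[e ^+ p]>).
    have chF : <[e ^+ p]> \char E by rewrite sub_cyclic_char.
    by rewrite -cycle_subG (char_norm_trans chF) // cycle_subG.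
  have /centP/(_ _ (cycle_id _))cae : a \in 'C(<[e ^+ p]>).
    rewrite (subsetP (cent_order_dvd2 _)) //= -orderE order_dvdn -expgM.
    exact/eqP.
  by rewrite conjgE -cae mulKg.
by rewrite expgMn // -conjXg cep -expgD addnn -muln2 e2p.
Qed.

(* Conjugation by [c] turns [[~ b, t]] into [[~ a, t]] and [b ^+ 4] into
   [(a * t) ^+ 4], which differs from [a ^+ 4] by a 6th power of [[~ a, t]];
   comparing the two forces [[~ b, t]] to have order at most 2. *)
Lemma commutator_order16 (gT : finGroupType) (G B C K : {group gT}) a b c t w :
    bicyclic G B C -> gcore C G = 1 -> B :=: <[b]> -> C :=: <[c]> ->
    #[b] = 16 -> K <| G -> K \subset B -> #|K| = 4 ->
    t \in C -> t \in 'C(K) -> t ^+ 4 = 1 ->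
    a = b ^+ w -> b ^ c = a * t -> [~ a, t] \in K ->
  t ^+ 2 = 1.
Proof.
move=> bicG cC1 defB defC ob /andP[_ nKG] sKB cardK Ct cKt t4 defa eq_bc Ka.
have [sBG sCG] := bicyclic_sub bicG; have [defG _ cycB cycC] := bicG.
have abB := cyclic_abelian cycB; have abC := cyclic_abelian cycC.
have Bb : b \in B by rewrite defB cycle_id.
have Ba : a \in B by rewrite defa groupX.
have Cc : c \in C by rewrite defC cycle_id.
have nKc : c \in 'N(K) by rewrite (subsetP nKG) ?(subsetP sCG).
have comK x y : x \in K -> y \in B -> commute y x.
  by move=> Kx By; apply: (centsP abB) => //; apply: (subsetP sKB).
have comt x : x \in K -> commute t x by move=> Kx; apply: (centP cKt).
have tc : t ^ c = t.
  by rewrite conjgE (centsP abC t Ct c Cc) mulKg.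
set c1 := [~ a, t] in Ka; pose c0 := [~ b, t].
have c0c : c0 ^ c = c1.
  rewrite conjRg tc eq_bc commMgJ commgg mulg1 -/c1.
  by rewrite conjgE -(comt _ Ka) mulKg.
have Kc0 : c0 \in K by rewrite -(memJ_norm c0 nKc) c0c.
have c1E : c1 = c0 ^+ w by rewrite /c1 defa commXg //; apply: comK.
have defK : K :=: <[b ^+ 4]>.
  apply/eqP; rewrite (eq_subG_cyclic (K := <[b ^+ 4]>%G) cycB) ?cycle_subG ?groupX //.
  by rewrite cardK -orderE orderXdiv ob.
have [v c0E] : exists v, c0 = b ^+ 4 ^+ v by apply/cycleP; rewrite -defK.
have c1V : [~ t, a] = c1^-1 by rewrite invg_comm.
(* The exponent 6 is 4 choose 2, the number of times [t] is moved past [a]. *)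
have at4 : (a * t) ^+ 4 = a ^+ 4 * c1^-1 ^+ 6.
  rewrite expMg_Rmul c1V ?t4 ?mulg1 //; first by apply/comt; rewrite groupV.
  by apply: comK; rewrite ?groupV.
have c1_6v : c1 ^+ 6 ^+ v = 1.
  apply: (mulgI (c1 ^+ 6 ^+ v)^-1).
  rewrite mulVg mulg1 -!expVgn.
  apply: (mulgI (a ^+ 4 ^+ v)); rewrite mulg1 -expgMn; last first.
    by apply: comK; rewrite ?groupX ?groupV.
  rewrite -at4 -eq_bc -!conjXg -c0E c0c c1E c0E defa -!expgM.
  by congr (b ^+ _); rewrite mulnC mulnA.
have c02 : c0 ^+ 2 = 1.
  (* For odd [v], [c1 ^+ 4 = 1] reduces [c1 ^+ 6 ^+ v] to [c1 ^+ 2]; for even [v], [c0 ^+ 2] is a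
     power of [b ^+ 16]. *)
  have [odd_v | even_v] := boolP (odd v).
    apply: (conjg_inj c); rewrite conjXg c0c conj1g.
    have c14 : c1 ^+ 4 = 1 by apply/eqP; rewrite -order_dvdn -cardK order_dvdG.
    move: c1_6v; rewrite -expgM -[v]odd_double_half odd_v -mul2n mulnDr mulnA.
    rewrite expgD [c1 ^+ (6 * 2 * _)]expgM -[(6 * true)%N]/(4 + 2)%N.
    by rewrite -[(6 * 2)%N]/(4 * 3)%N expgD [c1 ^+ (4 * 3)]expgM c14 !expg1n mulg1 mul1g.
  rewrite c0E -!expgM -[v]odd_double_half (negPf even_v) add0n -mul2n.
  rewrite (mulnC _ 2) !mulnA.
  by rewrite expgM -[X in b ^+ X]ob expg_order expg1n.
(* Now [t ^+ 2] commutes with [b], so it is central in [G]. *)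
suffices: t ^+ 2 \in gcore C G by rewrite cC1 => /set1gP.
apply: mem_gcore => g; rewrite -defG => /mulsgP[x y Bx Cy ->].
have cBt : t ^+ 2 \in 'C(B).
  rewrite defB cent_cycle; apply/cent1P/commute_sym/commgP.
  by rewrite commgX -/c0 ?c02 //; apply: comt.
have -> : t ^+ 2 ^ (x * y) = t ^+ 2 ^ y.
  by rewrite conjgM [t ^+ 2 ^ x]conjgE (centP cBt _ Bx) mulKg.
by rewrite groupJ // groupX.
Qed.

(** Conjugation raises [e] to a power modulo 4; the exponents 0 and 2 force [e = 1], leaving 1 and
    -1. *)
Lemma conj_cyclic_dvd4 (gT : finGroupType) (E : {group gT}) a e :
  cyclic E -> #|E| %| 4 -> e \in E -> a \in 'N(E) ->
  e ^ a = e \/ e ^ a = e^-1.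
Proof.
move=> cycE dvE Ee nEa.
have e4 : e ^+ 4 = 1.
  by apply/eqP; rewrite -order_dvdn (dvdn_trans (order_dvdG Ee)).
have nea : a \in 'N(<[e]>).
  have che : <[e]> \char E by rewrite sub_cyclic_char // cycle_subG.
  by rewrite -cycle_subG (char_norm_trans che) // cycle_subG.
have /cycleP[i eai] : e ^ a \in <[e]> by rewrite memJ_norm ?cycle_id.
have {}eai : e ^ a = e ^+ (i %% 4) by rewrite -(expg_mod _ e4) in eai.
case: (i %% 4) (ltn_pmod i (isT : 0 < 4)) eai => [|[|[|[|]]]] // _ eai.
- by left; move/eqP: eai; rewrite expg0 conjg_eq1 => /eqP ->; rewrite conj1g.
- by left.
- left; suffices e1 : e = 1 by rewrite e1 conj1g.
  have e2 : e ^+ 2 = 1.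
    by apply: (conjg_inj a); rewrite conjXg eai -expgM e4 conj1g.
  by apply: (conjg_inj a); rewrite eai e2 conj1g.
by right; rewrite eai; apply/eqP; rewrite eq_sym eq_invg_mul -expgS e4.
Qed.

(** Let [K] be the core and suppose an involution [z] of [B / K] centralizes [E]. Its conjugate
    [x ^+ 2 * (e ^ x * e)] by the image of [c] lies outside [B / K]. If [x] inverts [e], it equals
    [x ^+ 2]; if [x] fixes [e], lifting to [G] and [commutator_order16] give [e ^+ 2 = 1]. Both are
    contradictions. *)
Lemma core_quotient_order16 (gT : finGroupType) (G B C : {group gT}) :
    bicyclic G B C -> gcore C G = 1 ->
    #|gcore B G| = 4 -> #|B / gcore B G| = 4 ->
  C / gcore B G <| G / gcore B G.
Proof.
move=> bicG cC1 cardK cardQ; have [sBG sCG] := bicyclic_sub bicG.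
have [E [H [nsEQ sECK dvE [sHB nsHE [rT [G' [B' [C' [bic' cC1' cardB' cardK']]]]]]]]]
  := gcore_step bicG cC1.
have nsKG := gcore_normal sBG; have nKG := normal_norm nsKG.
have sKB : gcore B G \subset B := gcore_sub _ _.
have bicQ := bicyclic_quotient bicG nsKG sKB.
have [_ tiQ cycBq cycCq] := bicQ; have [sBQ sCQ] := bicyclic_sub bicQ.
have [_ tiBC /cyclicP[b defB] /cyclicP[c defC]] := bicG.
have sEC := subset_trans sECK (quotientS _ (subsetIl C _)).
have cycE : cyclic E := cyclicS sEC cycCq.
have B2 : 2.-group (B / gcore B G) by rewrite /pgroup cardQ.
have [// | [z [Bz oz cEz]]] := cent_normal_dichotomy bicQ B2 nsEQ sEC.
(* The next factorization has [#|B'| = 4], so its core, of the same order as [H], is all of [B']. *)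
have defH : H :=: B / gcore B G.
  by apply/eqP; rewrite eqEcard sHB cardQ -cardK' (gcore_order4 bic') ?cardB'.
rewrite defH in nsHE; rewrite cardK in dvE.
have Bb : b \in B by rewrite defB cycle_id.
have Cc : c \in C by rewrite defC cycle_id.
have nKb : b \in 'N(gcore B G) by rewrite (subsetP nKG) ?(subsetP sBG).
have nKc : c \in 'N(gcore B G) by rewrite (subsetP nKG) ?(subsetP sCG).
have defBq : B / gcore B G = <[coset (gcore B G) b]>.
  by rewrite -quotient_cycle // -defB.
have defCq : C / gcore B G = <[coset (gcore B G) c]>.
  by rewrite -quotient_cycle // -defC.
have Qc : coset (gcore B G) c \in G / gcore B G by rewrite mem_quotient ?(subsetP sCG).
have [x [e [Bx Ee eq_bc cEx2 eq_zc]]] :=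
  square_conj_order4 defBq cardQ Bz oz cEz nsHE Qc.
have cB1 := gcore_quotient_gcore sBG.
have nBzc : z ^ coset (gcore B G) c \notin B / gcore B G.
  apply/negP => Bzc.
  have: z ^ coset (gcore B G) c \in B / gcore B G :&: (B / gcore B G) :^ coset (gcore B G) c.
    by rewrite inE Bzc memJ_conjg.
  rewrite (gcore_capJ bicQ defCq cB1) => /set1gP/eqP.
  by rewrite conjg_eq1 -order_eq1 oz.
have nEx : x \in 'N(E) by rewrite (subsetP (normal_norm nsEQ)) ?(subsetP sBQ).
have [exe | exV] := conj_cyclic_dvd4 cycE dvE Ee nEx; last first.
  by case/negP: nBzc; rewrite eq_zc exV mulVg mulg1 groupX.
rewrite exe in eq_zc.
have [t nKt /setIP[Ct cKt] def_e] := morphimP (subsetP sECK e Ee).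
have [a nKa Ba def_x] := morphimP Bx.
have : coset (gcore B G) (b ^ c) = coset (gcore B G) (a * t).
  by rewrite morphJ // morphM // -def_x -def_e.
move/rcoset_kercosetP; rewrite groupJ ?groupM // => /(_ isT isT)/rcosetP[k Kk].
rewrite mulgA => eq_bat.
have Bka : k * a \in B by rewrite groupM // (subsetP sKB).
have /cycleP[w def_ka] : k * a \in <[b]> by rewrite -defB.
have nKk : k \in 'N(gcore B G) by rewrite (subsetP (normG _)).
have comm_at : [~ k * a, t] \in gcore B G.
  apply: coset_idr; first by rewrite groupR // groupM.
  have ka_x : coset (gcore B G) (k * a) = x.
    by rewrite morphM //= (coset_id Kk) mul1g def_x.
  rewrite morphR ?groupM //= ka_x -def_e.
  by apply/eqP/commgP/commute_sym/commgP/conjg_fixP; rewrite exe.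
have t4 : t ^+ 4 = 1.
  have : t ^+ 4 \in B :&: C.
    rewrite inE (groupX _ Ct) andbT (subsetP sKB) //.
    apply: coset_idr; rewrite ?groupX // morphX //= -def_e.
    by apply/eqP; rewrite -order_dvdn (dvdn_trans (order_dvdG Ee)).
  by rewrite tiBC => /set1gP.
have ob : #[b] = 16 by rewrite orderE -defB (card_core_quotient sBG) cardK cardQ.
have t2 := commutator_order16 bicG cC1 defB defC ob nsKG sKB cardK Ct cKt t4
             def_ka eq_bat comm_at.
case/negP: nBzc.
by rewrite eq_zc -[e * e]/(e ^+ 2) def_e -morphX // t2 morph1 mulg1 groupX.
Qed.

Lemma core_quotient_order4_odd (gT : finGroupType) (G B C : {group gT}) p :
    bicyclic G B C -> gcore C G = 1 -> odd p ->
    #|gcore B G| = (2 * p)%N -> #|B / gcore B G| = 4 ->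
  C / gcore B G <| G / gcore B G.
Proof.
move=> bicG cC1 odd_p cardK cardQ; have [sBG sCG] := bicyclic_sub bicG.
have [E [H [nsEQ sECK dvE [sHB nsHE [rT [G' [B' [C' [bic' cC1' cardB' cardK']]]]]]]]]
  := gcore_step bicG cC1.
have bicQ := bicyclic_quotient bicG (gcore_normal sBG) (gcore_sub _ _).
have [_ tiQ cycBq cycCq] := bicQ; have [sBQ _] := bicyclic_sub bicQ.
have sEC := subset_trans sECK (quotientS _ (subsetIl C _)).
have B2 : 2.-group (B / gcore B G) by rewrite /pgroup cardQ.
have [// | [z [Bz oz cEz]]] := cent_normal_dichotomy bicQ B2 nsEQ sEC.
have defH : H :=: B / gcore B G.
  by apply/eqP; rewrite eqEcard sHB cardQ -cardK' (gcore_order4 bic') ?cardB'.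
rewrite defH in nsHE; rewrite cardK in dvE.
by case: (no_order4_odd (gcore_quotient_gcore sBG) sBQ nsEQ nsHE cycBq
            (cyclicS sEC cycCq) cardQ odd_p dvE Bz oz cEz).
Qed.

(** With a core of order 2, [gcore_next] would lead to a factor of order 8 with core of order 2,
    then to one of order 4 with core of order at most 2, against [gcore_order4]. *)
Lemma gcore_order16_neq2 (gT : finGroupType) (G B C : {group gT}) :
    bicyclic G B C -> gcore C G = 1 -> #|B / gcore B G| = 8 ->
  #|gcore B G| != 2.
Proof.
move=> bicG cC1 cardQ; apply/eqP => cardK.
have [rT [G1 [B1 [C1 [bic1 cC1_1 cardB1 leK1]]]]] := gcore_next bicG cC1.
rewrite cardQ in cardB1; rewrite cardK in leK1.
have ntB1 : B1 :!=: 1 by rewrite -cardG_gt1 cardB1.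
have := gcore_neq1 bic1 cC1_1 ntB1; rewrite -cardG_gt1 => gtK1.
have cardK1 : #|gcore B1 G1| = 2 by apply/eqP; rewrite eqn_leq leK1.
have [sBG1 _] := bicyclic_sub bic1.
have := card_core_quotient sBG1; rewrite cardB1 cardK1 => card8.
have cardQ1 : #|B1 / gcore B1 G1| = 4.
  by apply/eqP; rewrite -(eqn_pmul2l (isT : 0 < 2)) -card8.
have [rT2 [G2 [B2 [C2 [bic2 cC1_2 cardB2 leK2]]]]] := gcore_next bic1 cC1_1.
by rewrite (gcore_order4 bic2) ?cardB2 ?cardK1 in leK2.
Qed.

Lemma core_quotient_normal (gT : finGroupType) (G B C : {group gT}) p :
    bicyclic G B C -> gcore C G = 1 -> prime p -> #|B| = (8 * p)%N ->
  C / gcore B G <| G / gcore B G.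
Proof.
move=> bicG cC1 p_pr cardB; have [sBG sCG] := bicyclic_sub bicG.
have bicQ := bicyclic_quotient bicG (gcore_normal sBG) (gcore_sub _ _).
have p_gt0 := prime_gt0 p_pr.
have ntB : B :!=: 1 by rewrite -cardG_gt1 cardB (leq_trans (isT : 1 < 8)) ?leq_pmulr.
have := gcore_neq1 bicG cC1 ntB; rewrite -cardG_gt1 => K_gt1.
have := card_core_quotient sBG; rewrite cardB => cardKQ.
have [leQ2 | gtQ2] := leqP #|B / gcore B G| 2; first exact: bicyclic_index2 bicQ leQ2.
have [p2 | odd_p] := even_prime p_pr.
  rewrite p2 in cardKQ.
  have : #|B / gcore B G| \in divisors 16.
    by rewrite -dvdn_divisors // [16]cardKQ dvdn_mull.
  rewrite !inE => /or4P[/eqP d1|/eqP d2|/eqP d4|].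
  - by rewrite d1 in gtQ2.
  - by rewrite d2 in gtQ2.
  - apply: (core_quotient_order16 bicG cC1 _ d4).
    by apply/eqP; rewrite -(eqn_pmul2r (isT : 0 < 4)) -[X in (_ * X)%N]d4 -cardKQ.
  case/orP=> /eqP d8.
    case/negP: (gcore_order16_neq2 bicG cC1 d8).
    by rewrite -(eqn_pmul2r (isT : 0 < 8)) -[X in (_ * X)%N]d8 -cardKQ.
  by rewrite d8 in cardKQ; rewrite -(ltn_pmul2r (isT : 0 < 16)) -cardKQ in K_gt1.
(* An odd [p] divides the order of the core: otherwise that order divides 8 and [gcore_2group] makes
   [B] a 2-group. *)
have [pK | npK] := boolP (p %| #|gcore B G|); last first.
  have K2 : 2.-group (gcore B G).
    apply: (@pnat_dvd _ 8) => //.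
    have co_Kp : coprime #|gcore B G| p by rewrite coprime_sym prime_coprime.
    by rewrite -(Gauss_dvdl 8 co_Kp) cardKQ dvdn_mulr.
  have := gcore_2group bicG cC1 K2; rewrite /pgroup cardB pnatM => /andP[_].
  by rewrite pnatE // !inE => /eqP p2; rewrite p2 in odd_p.
have [j cardK] := dvdnP pK.
have cardjQ : 8 = (j * #|B / gcore B G|)%N.
  by apply/eqP; rewrite -(eqn_pmul2r p_gt0) cardKQ cardK mulnAC.
have : #|B / gcore B G| \in divisors 8.
  by rewrite -dvdn_divisors // [8]cardjQ dvdn_mull.
rewrite !inE => /or4P[/eqP d1|/eqP d2|/eqP d4|/eqP d8].
- by rewrite d1 in gtQ2.
- by rewrite d2 in gtQ2.
- apply: (core_quotient_order4_odd bicG cC1 odd_p _ d4); rewrite cardK.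
  by congr (_ * p)%N; apply/eqP; rewrite -(eqn_pmul2r (isT : 0 < 4)) -[X in (_ * X)%N]d4 -cardjQ.
apply: (core_quotient_order8 bicG cC1 odd_p _ d8); rewrite cardK.
suffices -> : j = 1%N by rewrite mul1n.
by apply/eqP; rewrite -(eqn_pmul2r (isT : 0 < 8)) -[X in (_ * X)%N]d8 -cardjQ.
Qed.

(** * The skew product group of a skew morphism *)

Section SkewProduct.

Variables (B : finGroupType) (phi : {perm B}).
Hypothesis cycB : cyclic [set: B].
Hypothesis skew_phi : skew_morphism phi.

Let T (a : B) : {perm B} := actperm 'R a.
Let TB : {group {perm B}} := (actperm 'R @* [set: B])%G.
Let G : {group {perm B}} := (TB <*> <[phi]>)%G.

Let TE a x : T a x = x * a.
Proof. by rewrite /T actpermE. Qed.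

Let comB (x y : B) : x * y = y * x.
Proof. by apply: (centsP (cyclic_abelian cycB)); rewrite inE. Qed.

Let phiX1 i : (phi ^+ i) 1 = 1.
Proof.
have [phi1 _] := skew_phi.
by elim: i => [|i IHi]; rewrite ?perm1 // expgSr permM IHi.
Qed.

Let cycle_phi1 s : s \in <[phi]> -> s 1 = 1.
Proof. by case/cycleP => i ->. Qed.

Let mem_T a : T a \in TB.
Proof. by rewrite mem_morphim ?inE. Qed.

Let TBP t : t \in TB -> exists a, t = T a.
Proof. by case/morphimP => a _ _ ->; exists a. Qed.

(** As [B] is abelian, the skew identity becomes an exchange rule between translations and powers of
    [phi]. *)
Let T_phi a i : skew_exponent phi a i -> T a * phi = phi ^+ i * T (phi a).
Proof.
move=> /forallP ai; apply/permP => x.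
by rewrite !permM !TE comB (eqP (ai x)) comB.
Qed.

Let TB_cycle_sub : TB * <[phi]> \subset <[phi]> * TB.
Proof.
apply/subsetP => _ /mulsgP[_ _ /TBP[a ->] /cycleP[j ->] ->].
elim: j => [|j /mulsgP[s _ Cs /TBP[b ->] eq_ab]].
  by rewrite mulg1 -[T a]mul1g mem_mulg.
have [i _ bi] := skew_phi.2 b.
rewrite expgSr mulgA eq_ab -mulgA (T_phi bi) mulgA mem_mulg //.
by rewrite groupM // mem_cycle.
Qed.

Let defG : TB * <[phi]> = G.
Proof.
(* Both products have the same cardinality, so the inclusion [TB_cycle_sub] is an equality. *)
rewrite /G /= comm_joingE //; apply/eqP; rewrite eqEcard TB_cycle_sub /=.
have := mul_cardG <[phi]>%G TB; rewrite mulnC mul_cardG setIC => /eqP.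
by rewrite eqn_pmul2r ?cardG_gt0 // => /eqP ->.
Qed.

Let tiTB : TB :&: <[phi]> = 1.
Proof.
apply/trivgP/subsetP => _ /setIP[/TBP[a ->]] /cycle_phi1.
by rewrite TE mul1g => ->; rewrite inE /T morph1.
Qed.

Lemma skew_product_bicyclic : bicyclic G TB <[phi]>.
Proof. by split; rewrite ?cycle_cyclic ?morphim_cyclic. Qed.

(** Powers of [phi] fix 1 and translations are transitive, so a normal subgroup of [G] inside the
    cycle of [phi] fixes every point. *)
Lemma skew_product_gcore : gcore <[phi]> G = 1.
Proof.
apply/trivgP/subsetP => s cs; rewrite inE; apply/eqP/permP => a; rewrite perm1.
have Ga : T a^-1 \in G by rewrite mem_gen // inE mem_T.
have /(subsetP (gcore_sub _ _))/cycle_phi1 : s ^ T a^-1 \in gcore <[phi]> G.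
  by rewrite memJ_norm // (subsetP (gcore_norm _ _)).
rewrite conjgE /T -morphV ?inE // invgK !permM !actpermE /= mul1g.
by move/(canRL (mulgK _)); rewrite mul1g invgK.
Qed.

Lemma skew_product_card : #|TB| = #|B|.
Proof.
rewrite card_injm ?cardsT //; apply/injmP => a b _ _ /permP/(_ 1).
by rewrite !actpermE /= !mul1g.
Qed.

(** Modulo [K], conjugating [phi] by a translation gives a power of [phi]; evaluation at 1 yields
    [phi a = k * a] with [T k] in [K]. As [phi] normalizes [K], which consists of translations,
    [phi (k * x) = phi k * phi x], so an exponent for [a] is one for [k * a]. *)
Lemma coset_preserving_normal :
  <[phi]> / gcore TB G <| G / gcore TB G -> coset_preserving phi.
Proof.
set K := gcore TB G => nsCQ a.
have [sTG sCG] := bicyclic_sub skew_product_bicyclic.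
have nsKG : K <| G := gcore_normal sTG.
have nKG := normal_norm nsKG.
have Gphi : phi \in G by rewrite (subsetP sCG) ?cycle_id.
have Ga : T a \in G by rewrite (subsetP sTG).
have [k eq_k Kk] : exists2 k, phi a = k * a & T k \in K.
  have : coset K (phi ^ (T a)^-1) \in <[phi]> / K.
    rewrite morphJ ?groupV ?(subsetP nKG) // memJ_norm ?mem_quotient ?cycle_id //.
    by rewrite (subsetP (normal_norm nsCQ)) // mem_quotient ?groupV.
  case/morphimP=> s nKs Cs.
  have nKpa : phi ^ (T a)^-1 \in 'N(K) by rewrite (subsetP nKG) // groupJ ?groupV.
  move/(rcoset_kercosetP nKpa nKs).
  (* With the left coset, [s] acts before [t], and [s] fixes 1. *)
  rewrite (norm_rlcoset nKs) => /lcosetP[t Kt].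
  have [k def_t] := TBP (subsetP (gcore_sub _ _) t Kt).
  move/permP/(_ 1); rewrite conjgE invgK !permM TE mul1g (cycle_phi1 Cs) def_t TE mul1g.
  rewrite -morphV ?inE // actpermE /= => eq_k; exists k; last by rewrite -def_t.
  by rewrite -eq_k mulgKV.
have phi_k x : phi (k * x) = phi k * phi x.
  have : T k ^ phi \in TB.
    by rewrite (subsetP (gcore_sub TB G)) // memJ_norm // (subsetP nKG).
  case/TBP => k'; rewrite conjgE => /(canRL (mulKVg _)) eq_k'.
  have phi_kx y : phi (y * k) = phi y * k'.
    by move/permP/(_ y): eq_k'; rewrite !permM !TE.
  have phi_kk : phi k = k' by rewrite -[k]mul1g phi_kx skew_phi.1 mul1g.
  by rewrite comB phi_kx -phi_kk comB.
have [i_bnd /forallP ai] := skew_powerP a skew_phi.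
apply: skew_power_unique => //; apply/forallP => b.
by rewrite eq_k -mulgA !phi_k (eqP (ai b)) mulgA.
Qed.

End SkewProduct.

Local Close Scope group_scope.

Theorem theorem7p1 (p : nat) (B : finGroupType) (phi : {perm B}) :
  prime p -> cyclic [set: B] -> #|B| = (8 * p)%N ->
  skew_morphism phi -> coset_preserving phi.
Proof.
move=> p_pr cycB cardB skew_phi.
apply: (coset_preserving_normal cycB skew_phi).
apply: core_quotient_normal p_pr _.
- exact: skew_product_bicyclic.
- exact: skew_product_gcore.
by rewrite skew_product_card.
Qed.
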